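(* Let $p\ge 1$ be an integer and, for a positive integer $n$, let $g_{0,p}(n)$ be the number of functions $f:[n]\to[p]$ such that $f(i-1)+f(i+1)-2f(i)\le 0$ for all $i\in\{2,3,\ldots,n-1\}$. Then for every $n>2(p-1)$, $$g_{0,p}(n)=\sum_{m=1}^{p}\left(\sum_{j=0}^{m-1}a(j)\right)^2,$$ where $a(j)$ is the number of integer partitions of $j$.
   Context: $[n]=\{1,2,\ldots,n\}$. By the usual convention $a(0)=1$. *)

(* Defs.v *)
From mathcomp Require Import all_boot all_order all_algebra.

Set Implicit Arguments.
Unset Strict Implicit.
Unset Printing Implicit Defensive.

Import Order.TTheory GRing.Theory Num.Theory.

(* The set [m] = {1, ..., m} is carried by 'I_m; the ordinal i stands for the
   integer i + 1. *)
Definition elt (m : nat) (i : 'I_m) : int := i.+1%:Z.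

(* f(i-1) + f(i+1) - 2f(i) <= 0 whenever i-1, i, i+1 all lie in [n], that is,
   for 2 <= i <= n-1; here h stands for i-1 and j for i+1. *)
Definition concave (n p : nat) (f : {ffun 'I_n -> 'I_p}) : bool :=
  [forall h : 'I_n, forall i : 'I_n, forall j : 'I_n,
     ((elt h == elt i - 1) && (elt j == elt i + 1) ==>
      (elt (f h) + elt (f j) - 2 * elt (f i) <= 0))%R].

Definition g0 (p n : nat) : nat :=
  #|[set f : {ffun 'I_n -> 'I_p} | concave f]|.

(* Partitions are written as weakly decreasing lists of positive parts. *)
Definition is_partition (j : nat) (s : seq nat) : bool :=
  [&& sorted geq s, 0 \notin s & sumn s == j].

Lemma is_partition_bounded (j : nat) (s : seq nat) :
  is_partition j s -> size s <= j /\ all (fun k => k < j.+1) s.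
Proof.
case/and3P=> _ s0 /eqP <-; elim: s s0 => [|k s IHs] //=.
rewrite inE negb_or eq_sym -lt0n => /andP[k0 /IHs[szs lts]].
split; first by rewrite -add1n leq_add.
rewrite ltnS leq_addr /=; apply: sub_all lts => i /= lti.
by rewrite ltnS (leq_trans _ (leq_addl _ _)).
Qed.

(* By is_partition_bounded, no partition of j is lost by bounding its length
   and its parts by j. *)
Definition num_partitions (j : nat) : nat :=
  #|[set s : {bseq j of 'I_j.+1} | is_partition j (map val s)]|.

Lemma num_partitions0 : num_partitions 0 = 1.
Proof.
apply/eqP/cards1P; exists [bseq]; apply/setP=> s.
have -> : s = [bseq] by apply: val_inj; case: s => -[].
by rewrite !inE eqxx.
Qed.

(* Main.v *)
(** Let M be the maximum of a concave f.  The nonzero increments of f read from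
    the left up to the maximum, and from the right up to the maximum, form two
    partitions s and t of sum at most M, and f is recovered from (M, s, t) as M
    minus the tail sums of s and t counted from the two ends.  Conversely every
    such triple with M < p occurs: s and t together have at most 2M parts, which
    is at most the number n - 1 of increments. *)
Require Import Defs.
From mathcomp Require Import all_boot all_order all_algebra.
From mathcomp Require Import zify.

(** * Lists of positive parts and their tail sums *)

Lemma sumn_drop (s : seq nat) (i : nat) :
  sumn (drop i s) = nth 0 s i + sumn (drop i.+1 s).
Proof.
have [ltis|leis] := ltnP i (size s); first by rewrite (drop_nth 0 ltis).
by rewrite nth_default // !drop_oversize // (leq_trans leis).
Qed.

Lemma leq_sumn_drop (s : seq nat) (i : nat) : sumn (drop i s) <= sumn s.
Proof. by rewrite -{2}(cat_take_drop i s) sumn_cat leq_addl. Qed.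

Lemma sorted_geq_nthS (s : seq nat) (i : nat) :
  sorted geq s -> nth 0 s i.+1 <= nth 0 s i.
Proof.
move=> srt; have [ltis|leis] := ltnP i.+1 (size s); last by rewrite nth_default.
by move/(sortedP 0): srt; apply.
Qed.

Lemma nth_gt0 (s : seq nat) (i : nat) :
  0 \notin s -> i < size s -> 0 < nth 0 s i.
Proof.
by move=> s0 ltis; rewrite lt0n; apply: contraNneq s0 => <-; apply: mem_nth.
Qed.

Lemma size_leq_sumn (s : seq nat) : 0 \notin s -> size s <= sumn s.
Proof. by elim: s => //= x s IHs; rewrite inE negb_or => /andP[? /IHs]; lia. Qed.

(** [nth 0] pads with zeros, so when no part is 0 the first zero read marks the length. *)
Lemma eq_from_nth_no0 (s t : seq nat) :
  0 \notin s -> 0 \notin t -> nth 0 s =1 nth 0 t -> s = t.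
Proof.
move=> s0 t0 eq_st; apply: (@eq_from_nth _ 0) => [|i _]; last exact: eq_st.
case: (ltngtP (size s) (size t)) => // [lt_st|lt_ts].
  by have := nth_gt0 _ _ t0 lt_st; rewrite -eq_st nth_default.
by have := nth_gt0 _ _ s0 lt_ts; rewrite eq_st nth_default.
Qed.

(** * Partitions as plain lists, so that those of different sums share one type *)

Definition partitions (j : nat) : seq (seq nat) :=
  [seq map val (val s) |
     s <- enum [set s : {bseq j of 'I_j.+1} | is_partition j (map val s)]].

Lemma size_partitions (j : nat) : size (partitions j) = num_partitions j.
Proof. by rewrite size_map -cardE. Qed.

Lemma partitions_uniq (j : nat) : uniq (partitions j).
Proof.
rewrite map_inj_uniq ?enum_uniq // => s t /(inj_map val_inj).
exact: val_inj.
Qed.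

Lemma mem_partitions (j : nat) (s : seq nat) :
  (s \in partitions j) = is_partition j s.
Proof.
apply/mapP/idP => [[b]|sP]; first by rewrite mem_enum inE => bP ->.
have [szs /allP lts] := is_partition_bounded sP.
have szb : size (map (@inord j) s) <= j by rewrite size_map.
have sE : map val (map (@inord j) s) = s.
  by rewrite -map_comp map_id_in // => k /lts ltk /=; rewrite inordK.
by exists (Bseq szb) => //=; rewrite mem_enum inE /= sE.
Qed.

Definition partitions_below (m : nat) : seq (seq nat) :=
  [seq s | j <- iota 0 m, s <- partitions j].

Lemma size_partitions_below (m : nat) :
  size (partitions_below m) = \sum_(0 <= j < m) num_partitions j.
Proof.
rewrite size_allpairs_dep sumnE big_map /index_iota subn0.
by apply: eq_bigr => j _; rewrite size_partitions.
Qed.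

Lemma mem_partitions_below (m : nat) (s : seq nat) :
  (s \in partitions_below m) = [&& sorted geq s, 0 \notin s & sumn s < m].
Proof.
apply/allpairsPdep/and3P => [[j [t]]|[srt s0 lts]].
  rewrite mem_iota mem_partitions add0n /=.
  by case=> ltj /and3P[srt t0 /eqP Ej] ->; rewrite Ej.
exists (sumn s), s; rewrite mem_iota mem_partitions add0n /=.
by split=> //; apply/and3P.
Qed.

(** The blocks for different [j] are disjoint because a list determines its sum. *)
Lemma partitions_below_uniq (m : nat) : uniq (partitions_below m).
Proof.
apply: allpairs_uniq_dep => [|j _|]; [exact: iota_uniq|exact: partitions_uniq|].
move=> [j s] [k t] /allpairsPdep[j' [s' [_ sP [-> ->]]]].
move=> /allpairsPdep[k' [t' [_ tP [-> ->]]]] /= est.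
move: sP tP; rewrite !mem_partitions -est.
by move=> /and3P[_ _ /eqP <-] /and3P[_ _ /eqP <-].
Qed.

(** * Concave sequences on the indices 0 to [N] *)

Definition concave_upto (N : nat) (u : nat -> nat) : Prop :=
  forall i, i.+2 <= N -> u i + u i.+2 <= 2 * u i.+1.

Lemma concave_upto_rev (N : nat) (u : nat -> nat) :
  concave_upto N u -> concave_upto N (fun i => u (N - i)).
Proof.
move=> cvu i leiN; have := cvu (N - i.+2).
have -> : (N - i.+2).+2 = N - i by lia.
have -> : (N - i.+2).+1 = N - i.+1 by lia.
by lia.
Qed.

(** Increments of a concave sequence decrease, so after one that is at most 0 the sequence never
    rises again. *)
Lemma concave_upto_descent (N : nat) (u : nat -> nat) (k q : nat) :
  concave_upto N u -> u k.+1 <= u k -> k < q -> q <= N -> u q <= u k.+1.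
Proof.
move=> cvu desc ltkq leqN.
suff H d : k.+1 + d <= N -> u (k.+1 + d) <= u (k + d) /\ u (k.+1 + d) <= u k.+1.
  have [] := H (q - k.+1); first lia.
  by have -> : k.+1 + (q - k.+1) = q by lia.
elim: d => [|d IHd] led; first by rewrite !addn0.
have [] := IHd; first lia.
by have := cvu (k + d); rewrite !addnS !addSn; lia.
Qed.

(** The list [s] consists of the increments before the first position [r] of the maximum; its tail
    sums telescope to the distance from the maximum. The last clause makes [s] contribute nothing
    beyond [q], where the mirrored list takes over. *)
Lemma concave_upto_ascent (N q : nat) (u : nat -> nat) :
    concave_upto N u -> q <= N -> (forall i, i <= N -> u i <= u q) ->
  exists s, [/\ sorted geq s, 0 \notin s, sumn s <= u q,
    forall i, i <= q -> sumn (drop i s) = u q - u i &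
    forall i, q <= i -> sumn (drop i s) = 0].
Proof.
move=> cvu leqN umax; have exq : exists k, u k == u q by exists q.
case: (ex_minnP exq) => r /eqP urq rmin.
have lerq : r <= q by apply: rmin.
(* If [u] failed to rise at [k], descent would give [u q <= u k], so the maximum would be attained
   before [r]. *)
have ltr k : k < r -> u k < u k.+1.
  move=> ltkr; rewrite ltnNge; apply/negP => desc.
  have := concave_upto_descent _ _ _ q cvu desc.
  have : u k <> u q by move=> /eqP /rmin; rewrite leqNgt ltkr.
  by have := umax k; lia.
(* A fall from the maximum before [q] could not be made up by [q], again by descent. *)
have flat i : r <= i -> i <= q -> u i = u q.
  move=> leri leiq; apply/eqP; rewrite eqn_leq umax /=; last by lia.
  elim: i leri leiq => [|i IHi]; first by rewrite leqn0 -urq => /eqP ->.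
  rewrite leq_eqVlt => /predU1P[<- _|ltri leiq]; first by rewrite urq.
  rewrite leqNgt; apply/negP => desc.
  have := IHi ltri (ltnW leiq) => uqi.
  by have := concave_upto_descent _ _ _ q cvu (leq_trans (ltnW desc) uqi) leiq leqN; lia.
pose s := mkseq (fun k => u k.+1 - u k) r.
have ts i : i <= r -> sumn (drop i s) = u q - u i.
  move=> leir; have [d] : exists d, d = r - i by exists (r - i).
  elim: d i leir => [|d IHd] i leir.
    move=> d0; have -> : i = r by lia.
    by rewrite drop_oversize ?size_mkseq // urq subnn.
  move=> Ed; have ltir : i < r by lia.
  rewrite sumn_drop nth_mkseq // IHd //; last lia.
  by have := ltr _ ltir; have := umax i.+1; lia.
have t0 i : r <= i -> sumn (drop i s) = 0.
  by move=> leri; rewrite drop_oversize ?size_mkseq.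
exists s; split.
- apply/(sortedP 0) => i; rewrite size_mkseq => ltir.
  rewrite !nth_mkseq //; last lia.
  by have := cvu i; have := ltr i; have := ltr i.+1; rewrite /geq /=; lia.
- apply/negP => /mapP[k]; rewrite mem_iota => ltk; have := ltr k; lia.
- by have := ts 0; rewrite drop0 => ->; lia.
- move=> i leiq; have [leir|ltri] := leqP i r; first exact: ts.
  by rewrite t0 ?(ltnW ltri) // (flat i) ?(ltnW ltri) ?subnn.
- by move=> i leqi; apply: t0; lia.
Qed.

(** * Profiles: sequences rebuilt from a maximum and two partitions *)

Definition profile (N M : nat) (s t : seq nat) (i : nat) : nat :=
  M - (sumn (drop i s) + sumn (drop (N - i) t)).

(** The ascent lemma is applied to [u] and to its reversal at the same peak [q]; on each side of [q]
    only one of the two lists contributes. *)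
Lemma concave_upto_profile (N : nat) (u : nat -> nat) :
    concave_upto N u ->
  exists q s t, [/\ q <= N, (s \in partitions_below (u q).+1),
    (t \in partitions_below (u q).+1) &
    forall i, i <= N -> u i = profile N (u q) s t i].
Proof.
move=> cvu.
pose q : nat := [arg max_(j > ord0 : 'I_N.+1) u j].
have leqN : q <= N by rewrite -ltnS ltn_ord.
have umax i : i <= N -> u i <= u q.
  rewrite /q; case: arg_maxnP => //= j _ jmax leiN.
  by have := jmax (Ordinal (leiN : i < N.+1)) isT.
have [s [srs s0 les sl sr]] := concave_upto_ascent _ _ _ cvu leqN umax.
have [||t] := concave_upto_ascent N (N - q) _ (concave_upto_rev _ _ cvu).
- exact: leq_subr.
- by move=> i leiN; rewrite subKn // umax // leq_subr.
rewrite /= subKn // => -[srt t0 let_ tl tr].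
exists q, s, t; rewrite !mem_partitions_below srs s0 srt t0 !ltnS; split=> //.
move=> i leiN; rewrite /profile; have := umax _ leiN.
have [leiq|ltqi] := leqP i q; first by rewrite sl // tr ?leq_sub2l //; lia.
by rewrite sr ?(ltnW ltqi) // tl ?leq_sub2l ?(ltnW ltqi) // subKn //; lia.
Qed.

Lemma profile_rev (N M : nat) (s t : seq nat) (i : nat) :
  i <= N -> profile N M t s i = profile N M s t (N - i).
Proof. by move=> leiN; rewrite /profile subKn // addnC. Qed.

Section Profile.

Variables (N M : nat) (s t : seq nat).
Hypotheses (sP : s \in partitions_below M.+1) (tP : t \in partitions_below M.+1).
Hypothesis leMN : 2 * M <= N.

Lemma size_profile : size s + size t <= N.
Proof.
move: sP tP; rewrite !mem_partitions_below.
by case/and3P=> _ /size_leq_sumn s1 ? /and3P[_ /size_leq_sumn t1 ?]; lia.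
Qed.

(** The truncated subtraction in [profile] is exact: as the lengths add up to at most [N], at every
    index one of the two tails is empty, and the other has sum at most [M]. *)
Lemma profile_subK (i : nat) :
  i <= N -> profile N M s t i + (sumn (drop i s) + sumn (drop (N - i) t)) = M.
Proof.
move=> leiN; rewrite /profile subnK //; have szst := size_profile.
move: sP tP; rewrite !mem_partitions_below.
case/and3P=> _ _ les /and3P[_ _ let_].
have ? := leq_sumn_drop s i; have ? := leq_sumn_drop t (N - i).
have [leis|ltsi] := leqP (size s) i; first by rewrite (drop_oversize leis) /=; lia.
by rewrite (@drop_oversize _ (N - i) t) /=; lia.
Qed.

(** The increment at [i] is the entry of [s] at [i] minus the entry of [t] at [N - i.+1]. The first
    weakly decreases with [i] and the second weakly increases. *)
Lemma profile_concave : concave_upto N (profile N M s t).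
Proof.
move=> i leiN.
have := profile_subK i (ltnW (ltnW leiN)).
have := profile_subK i.+1 (ltnW leiN); have := profile_subK i.+2 leiN.
have := sumn_drop s i; have := sumn_drop s i.+1.
have := sumn_drop t (N - i.+2); have := sumn_drop t (N - i.+1).
have <- : N - i.+1 = (N - i.+2).+1 by lia.
have <- : N - i = (N - i.+1).+1 by lia.
move: sP tP; rewrite !mem_partitions_below => /and3P[srs _ _] /and3P[srt _ _].
have := sorted_geq_nthS s i srs; have := sorted_geq_nthS t (N - i.+2) srt.
have <- : N - i.+1 = (N - i.+2).+1 by lia.
by lia.
Qed.

(** At index [size s] both tails are empty, so the bound [M] is attained. *)
Lemma profile_peak : profile N M s t (size s) = M.
Proof.
have szst := size_profile.
by rewrite /profile drop_size drop_oversize /=; lia.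
Qed.

(** Truncation sends the descending increments, which come from [t], to 0, leaving exactly [s]
    padded with zeros. *)
Lemma profile_increment (i : nat) :
  i < N -> profile N M s t i.+1 - profile N M s t i = nth 0 s i.
Proof.
move=> ltiN; have szst := size_profile.
have := profile_subK i (ltnW ltiN); have := profile_subK i.+1 ltiN.
have := sumn_drop s i; have := sumn_drop t (N - i.+1).
have <- : N - i = (N - i.+1).+1 by lia.
have [leis|ltsi] := leqP (size s) i; first by rewrite (nth_default _ leis); lia.
by rewrite (@drop_oversize _ (N - i.+1) t) /=; lia.
Qed.

End Profile.

Lemma profile_le (N M : nat) (s t : seq nat) (i : nat) : profile N M s t i <= M.
Proof. exact: leq_subr. Qed.

Lemma profile_injl (N M : nat) (s t s' t' : seq nat) :
    s \in partitions_below M.+1 -> t \in partitions_below M.+1 ->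
    s' \in partitions_below M.+1 -> t' \in partitions_below M.+1 ->
    2 * M <= N ->
    (forall i, i <= N -> profile N M s t i = profile N M s' t' i) ->
  s = s'.
Proof.
move=> sP tP sP' tP' leMN eq_p.
have [sz sz'] := (size_profile _ _ _ _ sP tP leMN, size_profile _ _ _ _ sP' tP' leMN).
apply: eq_from_nth_no0 => [||i].
- by move: sP; rewrite mem_partitions_below => /and3P[].
- by move: sP'; rewrite mem_partitions_below => /and3P[].
(* From index [N] on, both lists read the default 0, having at most [N] parts. *)
have [ltiN|leNi] := ltnP i N; last by rewrite !nth_default //; lia.
rewrite -(profile_increment _ _ _ _ sP tP leMN) // eq_p // eq_p ?(ltnW ltiN) //.
exact: profile_increment.
Qed.

(** [M] is recovered as the maximum, [s] from the truncated increments, and [t] in the same way from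
    the reversed profile. *)
Lemma profile_inj (N M M' : nat) (s t s' t' : seq nat) :
    s \in partitions_below M.+1 -> t \in partitions_below M.+1 ->
    s' \in partitions_below M'.+1 -> t' \in partitions_below M'.+1 ->
    2 * M <= N -> 2 * M' <= N ->
    (forall i, i <= N -> profile N M s t i = profile N M' s' t' i) ->
  [/\ M = M', s = s' & t = t'].
Proof.
move=> sP tP sP' tP' leMN leMN' eq_p.
have [sz sz'] := (size_profile _ _ _ _ sP tP leMN, size_profile _ _ _ _ sP' tP' leMN').
have eqM : M = M'.
  apply/eqP; rewrite eqn_leq; apply/andP; split.
    by rewrite -(profile_peak _ _ _ _ sP tP leMN) eq_p ?profile_le //; lia.
  by rewrite -(profile_peak _ _ _ _ sP' tP' leMN') -eq_p ?profile_le //; lia.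
rewrite -{}eqM in sP' tP' eq_p {leMN' sz'} *; split=> //.
  exact: profile_injl sP tP sP' tP' leMN eq_p.
apply: (profile_injl _ _ _ _ _ _ tP sP tP' sP' leMN) => i leiN.
by rewrite (profile_rev _ _ s t) // (profile_rev _ _ s' t') // eq_p // leq_subr.
Qed.

(** * From functions to triples, and the count *)

Lemma concaveP (N p : nat) (f : {ffun 'I_N.+1 -> 'I_p}) :
  reflect (concave_upto N (fun i => f (inord i))) (concave f).
Proof.
apply: (iffP idP) => [/forallP cvf i leiN|cvf].
  have /forallP/(_ (inord i.+1))/forallP/(_ (inord i.+2))/implyP := cvf (inord i).
  (* The shifts by one in [elt] cancel in the second difference. *)
  rewrite /elt !inordK; [move=> cvi | lia..].
  by have := cvi ltac:(lia); lia.
apply/forallP => h; apply/forallP => i; apply/forallP => j.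
apply/implyP; rewrite /elt => /andP[/eqP hi /eqP ji].
have iE : i = h.+1 :> nat by lia.
have jE : j = i.+1 :> nat by lia.
have := cvf h; rewrite -iE -jE !inord_val.
by have := ltn_ord j; lia.
Qed.

Definition triples (p : nat) : seq (nat * (seq nat * seq nat)) :=
  [seq (M, st) | M <- iota 0 p,
     st <- [seq (s, t) | s <- partitions_below M.+1, t <- partitions_below M.+1]].

Lemma mem_triples (p M : nat) (s t : seq nat) :
  ((M, (s, t)) \in triples p) =
  [&& M < p, s \in partitions_below M.+1 & t \in partitions_below M.+1].
Proof.
apply/allpairsPdep/and3P => [[M' [_ [ltM /allpairsP[[s' t'] /= [sP tP ->]]]]]|].
  by case=> -> -> ->; move: ltM; rewrite mem_iota.
case=> ltM sP tP; exists M, (s, t); rewrite mem_iota; split=> //.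
by apply/allpairsP; exists (s, t).
Qed.

Lemma triples_uniq (p : nat) : uniq (triples p).
Proof.
apply: allpairs_uniq_dep => [|M _|[M st] [M' st'] _ _ /= [-> ->]] //.
  exact: iota_uniq.
by apply: allpairs_uniq => [||[? ?] [? ?] _ _ /= [-> ->]] //;
  exact: partitions_below_uniq.
Qed.

(** For each [M] the two partitions are chosen independently, which gives the square; the summation
    index is [m = M.+1]. *)
Lemma size_triples (p : nat) :
  size (triples p) =
  \sum_(1 <= m < p.+1) (\sum_(0 <= j < m) num_partitions j) ^ 2.
Proof.
rewrite size_allpairs_dep sumnE big_map big_add1 /index_iota subn0.
by apply: eq_bigr => M _; rewrite size_allpairs size_partitions_below mulnn.
Qed.

Theorem theorem2p1 (p n : nat) (hp : 1 <= p) (hn : 2 * (p - 1) < n) :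
  g0 p n = \sum_(1 <= m < p.+1) (\sum_(0 <= j < m) num_partitions j) ^ 2.
Proof.
(* With [p.+1] values and [N.+1] positions the bound on [n] reads [2 * p <= N], hence [2 * M <= N]
   for every [M < p.+1]. *)
case: p n hp hn => [//|p] [//|N] _; rewrite subn1 ltnS /= => hN.
pose F (x : nat * (seq nat * seq nat)) : {ffun 'I_N.+1 -> 'I_p.+1} :=
  [ffun i : 'I_N.+1 => inord (profile N x.1 x.2.1 x.2.2 i)].
have FE M s t i : M < p.+1 -> i <= N ->
    F (M, (s, t)) (inord i) = profile N M s t i :> nat.
  move=> ltM leiN; rewrite ffunE /= inordK inordK //.
  exact: leq_ltn_trans (profile_le _ _ _ _ _) ltM.
have Finj : {in triples p.+1 &, injective F}.
  move=> [M [s t]] [M' [s' t']]; rewrite !mem_triples.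
  case/and3P=> ltM sP tP /and3P[ltM' sP' tP'] eqF.
  have [||i leiN|-> -> ->] // := profile_inj N M M' s t s' t' sP tP sP' tP'.
  - by lia.
  - by lia.
  - by rewrite -!FE // eqF.
have Funiq : uniq (map F (triples p.+1)) by rewrite map_inj_in_uniq ?triples_uniq.
(* The images under [F] are listed without repetition, so it remains to see that they are exactly
   the concave functions. *)
rewrite -size_triples -(size_map F) -(card_uniqP Funiq); apply: eq_card => f.
rewrite inE; apply/concaveP/mapP => [cvf|[[M [s t]]]].
  have [q [s [t [leqN sP tP fE]]]] := concave_upto_profile _ _ cvf.
  (* The first component is the value of [f] at its peak [q]. *)
  exists (f (inord q) : nat, (s, t)); first by rewrite mem_triples ltn_ord sP tP.
  apply/ffunP => i; apply: ord_inj; have leiN : i <= N by rewrite -ltnS.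
  by rewrite -[i]inord_val FE // inord_val -fE ?inord_val.
rewrite mem_triples => /and3P[ltM sP tP] -> i leiN.
rewrite !FE //; try lia.
by apply: profile_concave => //; lia.
Qed.
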